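(* Let $\mu$ and $\lambda$ be two complex parameters. Then for all integers $n\ge1$, $$\begin{aligned}\sum_{k=0}^n\binom{n}{k}\binom{2k}{k}\left\lfloor\frac{k}{2}\right\rfloor\mu^k\lambda^{n-k}&=\mu\,2^{-2n+1}\sum_{k=0}^n\binom{2k}{k}\binom{2(n-k)}{n-k}(n-k)\lambda^k(\lambda+4\mu)^{n-1-k}\\&\quad-2^{-(2n+2)}\sum_{k=0}^n\binom{2k}{k}\binom{2(n-k)}{n-k}\lambda^k\left((\lambda+4\mu)^{n-k}-(\lambda-4\mu)^{n-k}\right).\end{aligned}$$
   Context: $\lfloor x\rfloor$ denotes the floor function. Convention: $0^0=1$. The $k=n$ term of the first sum on the right-hand side, which carries the factor $n-k=0$, is understood to be $0$ (also when $\lambda+4\mu=0$). *)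

(* Defs.v *)
From mathcomp Require Export all_boot all_order all_algebra.
From mathcomp Require Export reals.
From mathcomp.real_closed Require Export complex.

(* Complex numbers are R[i] for a realType R.  A factor (n - k) * z ^ (n - 1 - k)
   with an integer exponent vanishes at k = n for every z, including z = 0,
   since exprz is total; and 0 ^+ 0 = 1 by expr0. *)

(* Main.v *)
Require Import Defs.
From mathcomp Require Import ring zify.
Import Order.TTheory GRing.Theory Num.Theory.
Local Open Scope ring_scope.

(** Write [c_k] for the central binomial coefficient [binom(2k, k)].  The
    generating function of [c_m binom(m, j)] is [c_j t^j (1 - 4t)^(-j - 1/2)];
    multiplied by [(1 - 4t)^(-1/2)], the one of [c_k], it becomes
    [c_j t^j / (1 - 4t)^(j + 1)], whence
      [sum_(k + m = n) c_k c_m binom(m, j) = 4^(n - j) binom(n, j) c_j]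
    ([convolution_bin]).  Here this is proved without power series: the
    first-order recurrences of the two factors add up to a first-order
    recurrence for their convolution.

    Since the identity holds for each [j], it can be summed against arbitrary
    weights [w_j]: the binomial transform [f m = sum_j binom(m, j) w_j x^(m - j)]
    satisfies
      [sum_(k + m = n) c_k c_m x^k f m
         = sum_j 4^(n - j) binom(n, j) c_j w_j x^(n - j)]
    ([sum_central_bin_transform]).  With [x = lambda] and
    [w_j = floor(j / 2) (4 mu)^j] the right-hand side is [4^n] times the
    left-hand side of the theorem.  For these weights [f m] is explicit because
    [4 floor(j / 2) = 2 j - 1 + (-1)^j] ([bin_transform_half]): the term [2 j]
    gives the derivative-like term in [(lambda + 4 mu)^(m - 1)], and
    [- 1 + (-1)^j] gives the difference of the powers of [lambda + 4 mu] and
    [lambda - 4 mu]. *)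

Definition central_bin (k : nat) : nat := 'C(2 * k, k).

Lemma central_binS k :
  (k.+1 * central_bin k.+1 = 2 * (2 * k).+1 * central_bin k)%N.
Proof.
rewrite /central_bin (_ : 2 * k.+1 = (2 * k).+2)%N; last by lia.
have diag := mul_bin_diag (2 * k).+2 k.
have down := mul_bin_diag (2 * k).+1 k.
have sym : 'C((2 * k).+1, k) = 'C((2 * k).+1, k.+1).
  by rewrite -bin_sub; [congr binomial; lia | lia].
move: diag down; rewrite /= sym => <- down.
by rewrite (_ : (2 * k).+2 = 2 * k.+1)%N; [rewrite -mulnA -down; ring | lia].
Qed.

Lemma central_bin_mul_binS m j :
  ((m.+1 - j) * (central_bin m.+1 * 'C(m.+1, j))
   = 2 * (2 * m).+1 * (central_bin m * 'C(m, j)))%N.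
Proof.
have := mul_bin_down m.+1 j; rewrite /= => down.
by rewrite mulnCA -down mulnA -(mulnC m.+1) central_binS mulnA.
Qed.

(** In terms of generating functions, the hypotheses say that
    [(1 - 4t) u' = 2 u] and [(1 - 4t) t v' = (j + 2t) v].  The step works
    because the coefficients [2 (2k + 1)] and [2 (2m + 1)] add up to the
    constant [4 (n + 1)] along [k + m = n]. *)
Lemma convolution_step (u v : nat -> nat) j n :
    (forall k, k.+1 * u k.+1 = 2 * (2 * k).+1 * u k)%N ->
    (forall m, (m.+1 - j) * v m.+1 = 2 * (2 * m).+1 * v m)%N ->
    (forall m, m < j -> v m = 0)%N -> (j <= n)%N ->
  ((n.+1 - j) * \sum_(k < n.+2) u k * v (n.+1 - k)
   = 4 * n.+1 * \sum_(k < n.+1) u k * v (n - k))%N.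
Proof.
move=> uS vS v0 le_jn.
(* Split the factor [n + 1 - j] as [k + (m - j)] with [m = n + 1 - k];
   where the truncated subtraction breaks this, [v m] is zero. *)
transitivity (\sum_(k < n.+2) (k * u k) * v (n.+1 - k)
  + \sum_(k < n.+2) u k * ((n.+1 - k - j) * v (n.+1 - k)))%N.
  rewrite big_distrr -big_split /=; apply: eq_bigr => k _.
  have [lt_j|le_j] := ltnP (n.+1 - k) j; first by rewrite v0 // !muln0.
  have -> : (n.+1 - j = k + (n.+1 - k - j))%N by have := ltn_ord k; lia.
  by ring.
rewrite big_ord_recl mul0n add0n [X in (_ + X)%N]big_ord_recr /=.
rewrite subnn sub0n mul0n muln0 addn0 -big_split big_distrr /=.
apply: eq_bigr => k _; rewrite /bump leq0n add1n uS subSS subSn -1?ltnS //.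
rewrite -subSn -1?ltnS // [in X in (_ + X)%N]subSn -1?ltnS // vS.
rewrite (_ : (4 * n.+1 = 2 * (2 * k).+1 + 2 * (2 * (n - k)).+1)%N); last first.
  by have := ltn_ord k; lia.
by ring.
Qed.

Lemma convolution_bin n j : (j <= n)%N ->
  (\sum_(k < n.+1) central_bin k * (central_bin (n - k) * 'C(n - k, j))
   = 4 ^ (n - j) * 'C(n, j) * central_bin j)%N.
Proof.
move=> /subnK <-; elim: (n - j)%N => [|d IHd] {n}.
  rewrite add0n subnn expn0 binn big_ord_recl subn0 binn big1 => [|k _].
    by rewrite /central_bin bin0 !mul1n muln1 addn0.
  by rewrite lift0 [X in (_ * (_ * X))%N]bin_small ?muln0 //; have := ltn_ord k; lia.
rewrite addnK in IHd; rewrite addnK addSn.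
apply/eqP; rewrite -(eqn_pmul2l (ltn0Sn d)); apply/eqP.
have := @convolution_step central_bin (fun m => central_bin m * 'C(m, j))%N j
  (d + j) central_binS (central_bin_mul_binS^~ j).
rewrite -addSn addnK => -> //; last 2 first.
- by move=> m lt_mj; rewrite bin_small ?muln0.
- exact: leq_addl.
have := mul_bin_down (d.+1 + j) j; rewrite addnK addSn /= => down.
rewrite IHd expnS.
transitivity (4 * 4 ^ d * (d.+1 * 'C((d + j).+1, j)) * central_bin j)%N.
  by rewrite -down; ring.
by ring.
Qed.

Section BinomialTransform.

Variable K : comNzRingType.
Implicit Types (x y : K) (w : nat -> K).

Definition bin_transform w x m : K :=
  \sum_(j < m.+1) 'C(m, j)%:R * w j * x ^+ (m - j).

Lemma sum_central_bin_transform w x n :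
  \sum_(k < n.+1) (central_bin k * central_bin (n - k))%:R * x ^+ k
     * bin_transform w x (n - k)
  = \sum_(j < n.+1) 4 ^+ (n - j) * ('C(n, j) * central_bin j)%:R
     * w j * x ^+ (n - j).
Proof.
(* The powers of [x] combine to [x ^+ (n - j)], and the inner sums may run up
   to [n] because the binomial coefficient vanishes beyond [n - k]. *)
transitivity (\sum_(k < n.+1) \sum_(j < n.+1)
    (central_bin k * (central_bin (n - k) * 'C(n - k, j)))%:R
    * (w j * x ^+ (n - j))).
  apply: eq_bigr => k _; rewrite /bin_transform.
  have le_kn : ((n - k).+1 <= n.+1)%N by lia.
  rewrite (big_ord_widen _ (fun j => 'C(n - k, j)%:R * w j * x ^+ (n - k - j))
    le_kn) big_mkcond big_distrr /=; apply: eq_bigr => j _.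
  case: ltnP => [lt_j|le_j]; last by rewrite (bin_small le_j) !muln0 mul0r mulr0.
  have -> : (n - j = k + (n - k - j))%N by have := ltn_ord k; lia.
  by rewrite exprD !natrM; ring.
rewrite exchange_big; apply: eq_bigr => j _.
rewrite -big_distrl -natr_sum convolution_bin -1?ltnS //= !natrM natrX.
by ring.
Qed.

Lemma bin_transform_exp x y m : bin_transform (GRing.exp y) x m = (x + y) ^+ m.
Proof.
rewrite exprDn; apply: eq_bigr => j _.
by rewrite -(mulr_natl (_ * _)); ring.
Qed.

Lemma bin_transform_mulrn_exp x y m :
  bin_transform (fun j => j%:R * y ^+ j) x m = m%:R * y * (x + y) ^+ m.-1.
Proof.
case: m => [|m]; first by rewrite /bin_transform big_ord1 !mul0r mulr0 mul0r.
rewrite /bin_transform big_ord_recl !mul0r mulr0 mul0r add0r /=.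
rewrite -bin_transform_exp big_distrr; apply: eq_bigr => j _.
have := mul_bin_diag m.+1 j; rewrite /= => /(congr1 (GRing.natmul (1 : K))).
rewrite !natrM /bump leq0n add1n subSS exprS => diag.
transitivity (j.+1%:R * 'C(m.+1, j.+1)%:R * (y * y ^+ j * x ^+ (m - j))).
  by ring.
by rewrite -diag; ring.
Qed.

Lemma natr_half j : 4 * (j %/ 2)%:R = 2 * j%:R - 1 + (-1) ^+ j :> K.
Proof.
rewrite divn2 -[in RHS](odd_double_half j) exprD -mul2n exprM sqrrN expr1n.
by rewrite expr1n natrD natrM; case: (odd j) => /=; ring.
Qed.

Lemma bin_transform_half x y m :
  4 * bin_transform (fun j => (j %/ 2)%:R * y ^+ j) x m
  = 2 * (m%:R * y * (x + y) ^+ m.-1) - ((x + y) ^+ m - (x - y) ^+ m).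
Proof.
rewrite -bin_transform_mulrn_exp -!bin_transform_exp /bin_transform.
rewrite !big_distrr -!sumrB /=; apply: eq_bigr => j _.
rewrite (exprNn y).
transitivity ('C(m, j)%:R * (4 * (j %/ 2)%:R) * y ^+ j * x ^+ (m - j)).
  by ring.
by rewrite natr_half; ring.
Qed.

End BinomialTransform.

Theorem proposition10 (R : realType) (mu lambda : R[i]) (n : nat)
    (n_ge1 : (1 <= n)%N) :
  \sum_(0 <= k < n.+1)
     'C(n, k)%:R * 'C(2 * k, k)%:R * (k %/ 2)%:R * mu ^+ k * lambda ^+ (n - k)
  = mu * 2 ^ (- (2 * n%:Z) + 1) *
    (\sum_(0 <= k < n.+1)
       'C(2 * k, k)%:R * 'C(2 * (n - k), n - k)%:R * (n - k)%:R *
       lambda ^+ k * (lambda + 4 * mu) ^ (n%:Z - 1 - k%:Z))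
  - 2 ^ (- (2 * n%:Z + 2)) *
    (\sum_(0 <= k < n.+1)
       'C(2 * k, k)%:R * 'C(2 * (n - k), n - k)%:R * lambda ^+ k *
       ((lambda + 4 * mu) ^+ (n - k) - (lambda - 4 * mu) ^+ (n - k))).
Proof.
have nz2 : 2 != 0 :> R[i] by rewrite pnatr_eq0.
have nz4 : 4 != 0 :> R[i] by rewrite pnatr_eq0.
have nz4n : 4 ^+ n != 0 :> R[i] by rewrite expf_neq0.
have pow4 : 2 ^ (- (2 * n%:Z)) = (4 ^+ n)^-1 :> R[i].
  by rewrite -exprz_inv -PoszM -exprnP exprM exprVn -natrX exprVn.
have -> : 2 ^ (- (2 * n%:Z) + 1) = 2 / 4 ^+ n :> R[i].
  by rewrite expfzDr // pow4 expr1z mulrC.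
have -> : 2 ^ (- (2 * n%:Z + 2)) = (4 * 4 ^+ n)^-1 :> R[i].
  rewrite opprD expfzDr // pow4 invfM mulrC; congr (_ * _).
  by rewrite -[LHS]/(2 ^- 2) -natrX.
rewrite !big_mkord.
apply: (mulfI nz4n); apply: (mulfI nz4).
pose w j := (j %/ 2)%:R * (4 * mu) ^+ j.
transitivity (4 * \sum_(k < n.+1) (central_bin k * central_bin (n - k))%:R
    * lambda ^+ k * bin_transform _ w lambda (n - k)).
  rewrite sum_central_bin_transform; congr (_ * _).
  rewrite big_distrr; apply: eq_bigr => j _ /=.
  have -> : 4 ^+ n = 4 ^+ (n - j) * 4 ^+ j :> R[i].
    by rewrite -exprD subnK // -ltnS.
  by rewrite /w /central_bin exprMn natrM; ring.
set A := \sum_(k < n.+1) _ * _ ^ _; set B := \sum_(k < n.+1) _ * (_ - _).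
transitivity (8 * mu * A - B); last by field; rewrite nz4n.
rewrite /A /B !big_distrr -sumrB /=; apply: eq_bigr => k _.
rewrite mulrCA bin_transform_half natrM -!/(central_bin _).
have [lt_kn|le_nk] := ltnP k n; last first.
  by rewrite (_ : n - k = 0)%N ?expr0; [ring | lia].
have -> : n%:Z - 1 - k%:Z = (n - k).-1%:Z by lia.
by rewrite -exprnP; ring.
Qed.
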